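(* Assume $k>1$. Then for all sufficiently small $\varepsilon>0$ the energy surface $M_2:=H^{-1}(H(P_2)+\varepsilon)$ of the double spherical pendulum is homeomorphic to $S^2\times S^5$.
   Context: Double spherical pendulum. Let $m_1,m_2,l_1,l_2,g>0$. The configuration space is $Q=S^2\times S^2$, where $S^2\subset\mathbb{R}^3$ is the unit sphere; a point of $Q$ is $(q_1,q_2)$ with $q_i=(x_i,y_i,z_i)$, $|q_i|=1$. The potential is $V(q_1,q_2)=g m_2 l_2(kz_1+z_2)$ with slope $k=\frac{(m_1+m_2)l_1}{m_2l_2}$. The Lagrangian on $TQ$ is $L=\frac12\left(m_1\|l_1\dot q_1\|^2+m_2\|l_1\dot q_1+l_2\dot q_2\|^2\right)-V(q_1,q_2)$. The momenta are $p_1=m_1l_1^2\dot q_1+m_2l_1(l_1\dot q_1+l_2\dot q_2)$ and $p_2=m_2l_2(l_1\dot q_1+l_2\dot q_2)$. The phase space $M=T^*Q$ is identified via this (Legendre) transform with the set of $(p_1,p_2,q_1,q_2)\in(\mathbb{R}^3)^4$ satisfying $q_1\cdot q_1=q_2\cdot q_2=1$ and $q_1\cdot\dot q_1=q_2\cdot\dot q_2=0$, where $\dot q_1=\frac1{l_1}\left(\frac{p_1}{m_1l_1}-\frac{p_2}{m_1l_2}\right)$ and $\dot q_2=\frac1{l_2}\left(\frac{p_2}{m_2l_2}-\frac{p_1}{m_1l_1}+\frac{p_2}{m_1l_2}\right)$. The Hamiltonian on $M$ is $$H(p_1,p_2,q_1,q_2)=\frac12\left(\frac1{m_1}\left\|\frac{p_1}{l_1}-\frac{p_2}{l_2}\right\|^2+\frac1{m_2}\left\|\frac{p_2}{l_2}\right\|^2\right)+V(q_1,q_2).$$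 Let $0=(0,0,-1)$ and $\infty=(0,0,1)$ be the lowest and highest points of $S^2$. The critical points of $V$ on $Q$ are $P_1=(0,0)$, $P_2=(0,\infty)$, $P_3=(\infty,0)$, $P_4=(\infty,\infty)$. The same symbols denote the points of $T^*Q$ with zero momentum over them, so $H(P_i)=V(P_i)$. *)

(* Defs.v *)
From mathcomp Require Import all_boot all_order all_algebra.
From mathcomp Require Import all_classical all_reals all_analysis.
Import Order.TTheory GRing.Theory Num.Theory.
Import numFieldNormedType.Exports.

Set Implicit Arguments.
Unset Strict Implicit.
Unset Printing Implicit Defensive.

Local Open Scope classical_set_scope.
Local Open Scope ring_scope.

(* A and B carry their subspace topologies; f and g are total on the ambient
   types, but only their restrictions to A and B are constrained. *)
Definition homeomorphic (T U : topologicalType) (A : set T) (B : set U) : Prop :=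
  exists (f : T -> U) (g : U -> T),
    [/\ set_fun A B f, set_fun B A g &
     [/\ {in A, cancel f g}, {in B, cancel g f},
         {within A, continuous f} & {within B, continuous g}]].

Section Euclidean.
Variables (R : realType) (n : nat).

Definition dotp (u v : 'rV[R]_n) : R := \sum_(i < n) u 0 i * v 0 i.

(* The library norm on 'rV[R]_n is the sup norm, hence a separate notion
   (both norms induce the topology of 'rV[R]_n). *)
Definition enorm (u : 'rV[R]_n) : R := Num.sqrt (dotp u u).

End Euclidean.

Definition sphere (R : realType) (n : nat) : set 'rV[R]_n.+1 :=
  [set q | dotp q q = 1].
Arguments sphere : clear implicits.

Section Pendulum.
Variable R : realType.
Variables m1 m2 l1 l2 g : R.

Definition height (q : 'rV[R]_3) : R := q 0 ord_max.

Definition south_pole : 'rV[R]_3 := - delta_mx 0 ord_max.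
Definition north_pole : 'rV[R]_3 := delta_mx 0 ord_max.

Definition slope : R := ((m1 + m2) * l1) / (m2 * l2).

Definition potential (q1 q2 : 'rV[R]_3) : R :=
  g * m2 * l2 * (slope * height q1 + height q2).

(* The velocities expressed through the momenta, i.e. the inverse of
   p1 = m1 l1^2 q1' + m2 l1 (l1 q1' + l2 q2'), p2 = m2 l2 (l1 q1' + l2 q2'). *)
Definition velocity1 (p1 p2 : 'rV[R]_3) : 'rV[R]_3 :=
  l1^-1 *: ((m1 * l1)^-1 *: p1 - (m1 * l2)^-1 *: p2).
Definition velocity2 (p1 p2 : 'rV[R]_3) : 'rV[R]_3 :=
  l2^-1 *: ((m2 * l2)^-1 *: p2 - (m1 * l1)^-1 *: p1 + (m1 * l2)^-1 *: p2).

(* Points are (p1, p2, q1, q2); the set below is T*(S^2 x S^2), identified with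
   the tangent bundle by the Legendre transform and embedded in (R^3)^4. *)
Definition phase_space : set ('rV[R]_3 * 'rV[R]_3 * 'rV[R]_3 * 'rV[R]_3) :=
  [set x | let: (p1, p2, q1, q2) := x in
    [/\ sphere R 2 q1, sphere R 2 q2,
        dotp q1 (velocity1 p1 p2) = 0 & dotp q2 (velocity2 p1 p2) = 0]].

Definition hamiltonian (x : 'rV[R]_3 * 'rV[R]_3 * 'rV[R]_3 * 'rV[R]_3) : R :=
  let: (p1, p2, q1, q2) := x in
  2^-1 * (m1^-1 * enorm (l1^-1 *: p1 - l2^-1 *: p2) ^+ 2
          + m2^-1 * enorm (l2^-1 *: p2) ^+ 2)
  + potential q1 q2.

Definition P2 : 'rV[R]_3 * 'rV[R]_3 * 'rV[R]_3 * 'rV[R]_3 :=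
  (0, 0, south_pole, north_pole).

Definition energy_surface (c : R) :
    set ('rV[R]_3 * 'rV[R]_3 * 'rV[R]_3 * 'rV[R]_3) :=
  phase_space `&` [set x | hamiltonian x = c].

End Pendulum.
Arguments P2 : clear implicits.

(* Main.v *)
Require Import Defs.
From mathcomp Require Import all_boot all_order all_algebra.
From mathcomp Require Import all_classical all_reals all_analysis.
From mathcomp Require Import ring lra.
Import Order.TTheory GRing.Theory Num.Theory.
Import numFieldNormedType.Exports.

Set Implicit Arguments.
Unset Strict Implicit.
Unset Printing Implicit Defensive.

Local Open Scope classical_set_scope.
Local Open Scope ring_scope.

(** Why the energy surface is a product of spheres.  Write [k] for the slope,
    [c0 = g * m2 * l2] and [kappa = c0 * k].  At energy [V P2 + e] the energy
    equation reads
      [kinetic energy + kappa * (1 + z1) = c0 * (1 - z2) + e].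
    The right-hand side, the energy left once the second pendulum sits at [q2],
    lies strictly between [0] and [2 * kappa], since [k > 1]
    and [e] is small.  Hence [q1] never reaches the north pole, while every
    [q2] occurs: the accessible configurations form a disc bundle over the
    sphere of the [q2]'s, centred at the south pole in each fibre.

    Over the punctured sphere everything in sight can be trivialised.  The
    kinetic energy is brought to a sum of squares of two tangent vectors by
    completing a square (velocity_surface_sheared) and by an explicit square
    root of a rank one perturbation of the identity (sheared_surface_stretch).
    The tangent plane at [q1] is carried to the horizontal plane by the
    reflection that exchanges [q1] and the north pole, and [q1] itself is
    replaced by a point [a] of a plane disc such that [kappa * (1 + z1)] becomes
    the squared norm of [a] (sheared_surface_sphere_bundle; this is the Lambert
    azimuthal projection).  What remains is
      [|b|^2 + |y|^2 + |a|^2 = c0 * (1 - z2) + e],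
    with [b] in a fixed plane, [a] in the plane of pairs of scalars and [y]
    tangent to the sphere at [q2]: a sphere bundle in the sum of a trivial
    bundle of rank four and the tangent bundle of the 2-sphere.  The sum of that
    tangent bundle and one trivial line, the normal line, is trivial of rank
    three, so the whole sum is trivial of rank six, and rescaling each fibre to
    unit radius gives the product with the 5-sphere (sphere_bundle_spheres). *)

(** * Homeomorphisms between subsets *)

Section Homeomorphic.
Context {T U : topologicalType}.

(** All maps below are given by formulas that remain continuous at each point of
    the source in the ambient space, which is easier to check than relative
    continuity. *)
Lemma homeomorphic_of_continuous_at (A : set T) (B : set U)
    (f : T -> U) (g : U -> T) :
  (forall x, A x -> [/\ B (f x), g (f x) = x & continuous_at x f]) ->
  (forall y, B y -> [/\ A (g y), f (g y) = y & continuous_at y g]) ->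
  homeomorphic A B.
Proof.
move=> fP gP; exists f, g; split.
- by move=> x /fP[].
- by move=> y /gP[].
- split.
  + by move=> x /set_mem/fP[].
  + by move=> y /set_mem/gP[].
  + by apply: continuous_in_subspaceT => x /set_mem/fP[].
  + by apply: continuous_in_subspaceT => y /set_mem/gP[].
Qed.

Lemma continuous_within_comp {V : topologicalType} (A : set T) (B : set U)
    (f : T -> U) (g : U -> V) :
  set_fun A B f -> {within A, continuous f} -> {within B, continuous g} ->
  {within A, continuous (g \o f)}.
Proof.
move=> fAB /subspace_continuousP cf /subspace_continuousP cg.
apply/subspace_continuousP => x Ax.
apply: cvg_comp (cg (f x) (fAB _ Ax)) => W /= BW.
have := cf x Ax [set y | B y -> W y] BW.
rewrite /nbhs /= /within /=.
by apply: filterS => z fzW Az; exact: fzW Az (fAB _ Az).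
Qed.

End Homeomorphic.

Lemma homeomorphic_trans {T U V : topologicalType}
    {A : set T} {B : set U} {C : set V} :
  homeomorphic A B -> homeomorphic B C -> homeomorphic A C.
Proof.
move=> [f [g [fAB gBA [fK gK cf cg]]]] [f' [g' [fBC gCB [fK' gK' cf' cg']]]].
exists (f' \o f), (g \o g'); split.
- by move=> x Ax; apply/fBC/fAB.
- by move=> z Cz; apply/gBA/gCB.
- split.
  + move=> x Ax /=; rewrite fK' ?fK//.
    exact/mem_set/fAB/set_mem.
  + move=> z Cz /=; rewrite gK ?gK'//.
    exact/mem_set/gCB/set_mem.
  + exact: continuous_within_comp cf cf'.
  + exact: continuous_within_comp cg' cg.
Qed.

(** * Continuity of vector-valued formulas *)

Definition vec3 {R : realType} (a b c : R) : 'rV[R]_3 :=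
  \row_(i < 3) nth 0 [:: a; b; c] i.

Lemma vec3K (R : realType) (u : 'rV[R]_3) :
  vec3 (u 0 0) (u 0 1) (height u) = u.
Proof.
apply/rowP => i; rewrite mxE /height.
by case: i => [[|[|[|//]]] ?] /=; congr (u _ _); exact: val_inj.
Qed.

Lemma vec3_0 (R : realType) (a b c : R) : vec3 a b c 0 0 = a.
Proof. by rewrite mxE. Qed.

Lemma vec3_1 (R : realType) (a b c : R) : vec3 a b c 0 1 = b.
Proof. by rewrite mxE. Qed.

Lemma height_vec3 (R : realType) (a b c : R) : height (vec3 a b c) = c.
Proof. by rewrite /height mxE. Qed.

Section ContinuousAt.
Context {R : realType} {T : topologicalType} (x : T).

Lemma continuous_at_fst (U V : topologicalType) (F : T -> U * V) :
  continuous_at x F -> continuous_at x (fun t => (F t).1).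
Proof. by move=> cF; apply: (continuous_comp cF); exact: cvg_fst. Qed.

Lemma continuous_at_snd (U V : topologicalType) (F : T -> U * V) :
  continuous_at x F -> continuous_at x (fun t => (F t).2).
Proof. by move=> cF; apply: (continuous_comp cF); exact: cvg_snd. Qed.

Lemma continuous_at_pair (U V : topologicalType) (F : T -> U) (G : T -> V) :
  continuous_at x F -> continuous_at x G ->
  continuous_at x (fun t => (F t, G t)).
Proof. by move=> cF cG; exact: cvg_pair. Qed.

Lemma continuous_at_coord m n (F : T -> 'M[R]_(m, n)) i j :
  continuous_at x F -> continuous_at x (fun t => F t i j).
Proof.
move=> cF; exact: (continuous_comp cF (@coord_continuous R m n i j (F x))).
Qed.

Lemma continuous_at_height (F : T -> 'rV[R]_3) :
  continuous_at x F -> continuous_at x (fun t => height (F t)).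
Proof. exact: continuous_at_coord. Qed.

Lemma continuous_at_mx m n (F : T -> 'M[R]_(m, n)) :
  (forall i j, continuous_at x (fun t => F t i j)) ->
  continuous_at x F.
Proof.
move=> cF A [P nP PA].
have PF : \forall t \near x,
    forall ij : 'I_m * 'I_n, P ij.1 ij.2 (F t ij.1 ij.2).
  by apply: filter_forall => -[i j]; exact: cF (nP i j).
by apply: filterS PF => t Pt; apply: PA => i j; exact: Pt (i, j).
Qed.

Lemma continuous_at_D (V : normedModType R) (F G : T -> V) :
  continuous_at x F -> continuous_at x G ->
  continuous_at x (fun t => F t + G t).
Proof. by move=> cF cG; exact: cvgD. Qed.

Lemma continuous_at_M (F G : T -> R) :
  continuous_at x F -> continuous_at x G ->
  continuous_at x (fun t => F t * G t).
Proof. by move=> cF cG; exact: cvgM. Qed.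

Lemma continuous_at_N (V : normedModType R) (F : T -> V) :
  continuous_at x F -> continuous_at x (fun t => - F t).
Proof. by move=> cF; exact: cvgN. Qed.

Lemma continuous_at_Z (V : normedModType R) (k : T -> R) (F : T -> V) :
  continuous_at x k -> continuous_at x F ->
  continuous_at x (fun t => k t *: F t).
Proof. by move=> ck cF; exact: cvgZ. Qed.

Lemma continuous_at_V (F : T -> R) : F x != 0 ->
  continuous_at x F -> continuous_at x (fun t => (F t)^-1).
Proof. by move=> F0 cF; exact: cvgV. Qed.

Lemma continuous_at_sqrt (F : T -> R) :
  continuous_at x F -> continuous_at x (fun t => Num.sqrt (F t)).
Proof. by move=> cF; apply: (continuous_comp cF); exact: sqrt_continuous. Qed.

Lemma continuous_at_X (F : T -> R) k :
  continuous_at x F -> continuous_at x (fun t => F t ^+ k).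
Proof.
move=> cF; exact: (continuous_comp cF (@exprn_continuous _ k (F x))).
Qed.

Lemma continuous_at_dotp n (F G : T -> 'rV[R]_n) :
  continuous_at x F -> continuous_at x G ->
  continuous_at x (fun t => dotp (F t) (G t)).
Proof.
move=> cF cG; rewrite /dotp; elim: (index_enum _) => [|i r IHr].
  by under eq_fun do rewrite big_nil; exact: cvg_cst.
under eq_fun do rewrite big_cons.
apply: continuous_at_D => //.
by apply: continuous_at_M; apply: continuous_at_coord.
Qed.

Lemma continuous_at_row_mx m n (F : T -> 'rV[R]_m) (G : T -> 'rV[R]_n) :
  continuous_at x F -> continuous_at x G ->
  continuous_at x (fun t => row_mx (F t) (G t)).
Proof.
move=> cF cG; apply: continuous_at_mx => i j.
under eq_fun do rewrite mxE.
by case: (fintype.split j) => k; exact: continuous_at_coord.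
Qed.

Lemma continuous_at_lsubmx m n (F : T -> 'rV[R]_(m + n)) :
  continuous_at x F -> continuous_at x (fun t => lsubmx (F t)).
Proof.
move=> cF; apply: continuous_at_mx => i j.
under eq_fun do rewrite mxE.
exact: continuous_at_coord.
Qed.

Lemma continuous_at_rsubmx m n (F : T -> 'rV[R]_(m + n)) :
  continuous_at x F -> continuous_at x (fun t => rsubmx (F t)).
Proof.
move=> cF; apply: continuous_at_mx => i j.
under eq_fun do rewrite mxE.
exact: continuous_at_coord.
Qed.

Lemma continuous_at_vec3 (a b c : T -> R) :
  continuous_at x a -> continuous_at x b -> continuous_at x c ->
  continuous_at x (fun t => vec3 (a t) (b t) (c t)).
Proof.
move=> ca cb cc; apply: continuous_at_mx => i j.
under eq_fun do rewrite mxE.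
by case: j => [[|[|[|//]]] ?] /=.
Qed.

End ContinuousAt.

(** The function under each operation is passed explicitly to the closure lemma:
    left to unification, failing candidates would unfold the whole algebraic
    hierarchy.  Nonvanishing denominators are left as goals. *)
Ltac continuity :=
  try assumption;
  lazymatch goal with
  | |- continuous_at _ (fun=> ?c) => exact: cvg_cst
  | |- continuous_at _ (fun t => t) => exact: cvg_id
  | |- continuous_at _ fst => exact: cvg_fst
  | |- continuous_at _ snd => exact: cvg_snd
  | |- continuous_at _ (fun t => (@?F t, @?G t)) =>
      apply: (continuous_at_pair (F := F) (G := G)); continuity
  | |- continuous_at _ (fun t => (@?F t).1) =>
      apply: (continuous_at_fst (F := F)); continuity
  | |- continuous_at _ (fun t => (@?F t).2) =>
      apply: (continuous_at_snd (F := F)); continuity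
  | |- continuous_at _ (fun t => vec3 (@?F t) (@?G t) (@?H t)) =>
      apply: (continuous_at_vec3 (a := F) (b := G) (c := H)); continuity
  | |- continuous_at _ (fun t => row_mx (@?F t) (@?G t)) =>
      apply: (continuous_at_row_mx (F := F) (G := G)); continuity
  | |- continuous_at _ (fun t => lsubmx (@?F t)) =>
      apply: (continuous_at_lsubmx (F := F)); continuity
  | |- continuous_at _ (fun t => rsubmx (@?F t)) =>
      apply: (continuous_at_rsubmx (F := F)); continuity
  | |- continuous_at _ (fun t => dotp (@?F t) (@?G t)) =>
      apply: (continuous_at_dotp (F := F) (G := G)); continuity
  | |- continuous_at _ (fun t => Num.sqrt (@?F t)) =>
      apply: (continuous_at_sqrt (F := F)); continuity
  | |- continuous_at _ (fun t => (@?F t) ^+ ?k) =>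
      apply: (continuous_at_X (F := F)); continuity
  | |- continuous_at _ (fun t => (@?F t)^-1) =>
      apply: (continuous_at_V (F := F)); continuity
  | |- continuous_at _ (fun t => - (@?F t)) =>
      apply: (continuous_at_N (F := F)); continuity
  | |- continuous_at _ (fun t => @?F t + @?G t) =>
      apply: (continuous_at_D (F := F) (G := G)); continuity
  | |- continuous_at _ (fun t => @?F t *: @?G t) =>
      apply: (continuous_at_Z (k := F) (F := G)); continuity
  | |- continuous_at _ (fun t => @?F t * @?G t) =>
      apply: (continuous_at_M (F := F) (G := G)); continuity
  | |- continuous_at _ (fun t => height (@?F t)) =>
      apply: (continuous_at_height (F := F)); continuity
  | |- continuous_at _ (fun t => fun_of_matrix (@?F t) ?i ?j) =>
      apply: (continuous_at_coord (F := F)); continuity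
  | |- _ => idtac
  end.

(** * The Euclidean scalar product *)

Section Dot.
Context {R : realType} {n : nat}.
Implicit Types (u v w : 'rV[R]_n) (a : R).

Lemma dotpC u v : dotp u v = dotp v u.
Proof. by apply: eq_bigr => i _; rewrite mulrC. Qed.

Lemma dotpDl u v w : dotp (u + v) w = dotp u w + dotp v w.
Proof. by rewrite -big_split; apply: eq_bigr => i _; rewrite mxE mulrDl. Qed.

Lemma dotpZl a u v : dotp (a *: u) v = a * dotp u v.
Proof. by rewrite mulr_sumr; apply: eq_bigr => i _; rewrite mxE mulrA. Qed.

Lemma dotpNl u v : dotp (- u) v = - dotp u v.
Proof. by rewrite -scaleN1r dotpZl mulN1r. Qed.

Lemma dotpDr u v w : dotp w (u + v) = dotp w u + dotp w v.
Proof. by rewrite dotpC dotpDl !(dotpC w). Qed.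

Lemma dotpZr a u v : dotp u (a *: v) = a * dotp u v.
Proof. by rewrite dotpC dotpZl dotpC. Qed.

Lemma dotpNr u v : dotp u (- v) = - dotp u v.
Proof. by rewrite dotpC dotpNl dotpC. Qed.

Definition dotpE := (dotpDl, dotpDr, dotpZl, dotpZr, dotpNl, dotpNr).

Lemma dotp_ge0 u : 0 <= dotp u u.
Proof. by apply: sumr_ge0 => i _; rewrite -expr2 sqr_ge0. Qed.

Lemma sqr_enorm u : enorm u ^+ 2 = dotp u u.
Proof. by rewrite sqr_sqrtr // dotp_ge0. Qed.

End Dot.

Lemma dotp_row_mx (R : realType) m n (u u' : 'rV[R]_m) (v v' : 'rV[R]_n) :
  dotp (row_mx u v) (row_mx u' v') = dotp u u' + dotp v v'.
Proof.
rewrite /dotp big_split_ord /=.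
by congr (_ + _); apply: eq_bigr => i _; rewrite ?row_mxEl ?row_mxEr.
Qed.

Lemma dotp3E (R : realType) (u v : 'rV[R]_3) :
  dotp u v = u 0 0 * v 0 0 + u 0 1 * v 0 1 + height u * height v.
Proof.
rewrite /dotp !big_ord_recr big_ord0 /= add0r /height.
by congr (u _ _ * v _ _ + u _ _ * v _ _ + u _ _ * v _ _); exact: val_inj.
Qed.

Lemma dotp_north (R : realType) (u : 'rV[R]_3) :
  dotp u (north_pole R) = height u.
Proof.
by rewrite dotp3E /north_pole {2}/height !mxE /= !mulr0 !add0r mulr1.
Qed.

Lemma height_north (R : realType) : height (north_pole R) = 1.
Proof. by rewrite /height mxE !eqxx. Qed.

(** * Trivialising the tangent bundle away from the north pole *)

Section Geometry.
Context {R : realType}.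
Local Notation V := 'rV[R]_3.
Implicit Types (q u v d y : V).
Local Notation N := (north_pole R).

(** The orthogonal reflection of mirror [(q - N)^perp]; the denominator is
    [|q - N|^2 / 2] for a unit vector [q].  It exchanges [q] and [N], hence the
    planes tangent to the sphere at these two points. *)
Definition swap_north q v : V :=
  v - (dotp v (q - N) / (1 - height q)) *: (q - N).

Lemma oneB_height_neq0 q : height q < 1 -> 1 - height q != 0.
Proof. by rewrite subr_eq0 => h; rewrite gt_eqF. Qed.

Lemma dotp_swap_north q u v : dotp q q = 1 -> height q < 1 ->
  dotp (swap_north q u) v = dotp u (swap_north q v).
Proof.
move=> q1 /oneB_height_neq0 h; rewrite /swap_north !dotpE.
rewrite (dotpC q v) (dotpC N v); ring.
Qed.

Lemma swap_northK q : dotp q q = 1 -> height q < 1 ->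
  involutive (swap_north q).
Proof.
move=> q1 /oneB_height_neq0 h v.
rewrite {1}/swap_north.
have -> : dotp (swap_north q v) (q - N) = - dotp v (q - N).
  rewrite /swap_north !dotpE q1 (dotpC N q) !dotp_north height_north.
  by field.
by rewrite mulNr scaleNr opprK /swap_north subrK.
Qed.

Lemma swap_north_north q : dotp q q = 1 -> height q < 1 ->
  swap_north q N = q.
Proof.
move=> q1 /oneB_height_neq0 h.
rewrite /swap_north !dotpE !(dotpC N q) !dotp_north height_north.
have -> : (height q - 1) / (1 - height q) = -1 by field.
by rewrite scaleN1r opprK addrCA subrr addr0.
Qed.

Lemma swap_north_self q : dotp q q = 1 -> height q < 1 ->
  swap_north q q = N.
Proof. by move=> q1 h; rewrite -{2}(swap_north_north q1 h) swap_northK. Qed.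

Lemma continuous_at_swap_north (T : topologicalType) (x : T) (q v : T -> V) :
  height (q x) < 1 -> continuous_at x q -> continuous_at x v ->
  continuous_at x (fun t => swap_north (q t) (v t)).
Proof.
by move=> /oneB_height_neq0 h cq cv; rewrite /swap_north; continuity.
Qed.

Lemma height_ge q : dotp q q = 1 -> -1 <= height q.
Proof. by rewrite dotp3E => h; nra. Qed.

Lemma height_le q : dotp q q = 1 -> height q <= 1.
Proof. by rewrite dotp3E => h; nra. Qed.

(** * A square root of a rank one perturbation of the identity *)

(** In the plane orthogonal to [q], the quadratic form
    [|u|^2 + tau * (u . c)^2] is turned into a squared norm by stretching the
    plane along the projection [c'] of [c], whose squared length is
    [1 - (q . c)^2], by the factor [r = sqrt (1 + tau * |c'|^2)].  Writing the
    coefficient [(r - 1) / |c'|^2] as [tau / (1 + r)] keeps it continuous where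
    [c'] vanishes, that is where [q] and [c] are parallel. *)
Definition stretch_factor (tau : R) q c : R :=
  Num.sqrt (1 + tau * (1 - dotp q c ^+ 2)).

Definition stretch tau q c u : V :=
  u + (tau / (1 + stretch_factor tau q c) * dotp u c) *: (c - dotp q c *: q).

Definition unstretch tau q c d : V :=
  d - (tau / (1 + stretch_factor tau q c) / stretch_factor tau q c * dotp d c)
      *: (c - dotp q c *: q).

Lemma dotp_le1 q c : dotp q q = 1 -> dotp c c = 1 -> dotp q c ^+ 2 <= 1.
Proof.
move=> q1 c1; have := dotp_ge0 (c - dotp q c *: q).
rewrite !dotpE q1 c1 (dotpC c q); lra.
Qed.

Section Stretch.
Variables (tau : R) (q c : V).
Hypotheses (tau_ge0 : 0 <= tau) (q1 : dotp q q = 1) (c1 : dotp c c = 1).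
Let r := stretch_factor tau q c.

Let r_sqr : r ^+ 2 = 1 + tau * (1 - dotp q c ^+ 2).
Proof. by rewrite sqr_sqrtr // addr_ge0 // mulr_ge0 // subr_ge0 dotp_le1. Qed.

Lemma stretch_factor_gt0 : 0 < stretch_factor tau q c.
Proof. by rewrite sqrtr_gt0 ltr_wpDr // mulr_ge0 // subr_ge0 dotp_le1. Qed.

Let r_gt0 : 0 < r := stretch_factor_gt0.
Let r_neq0 : r != 0. Proof. exact: lt0r_neq0. Qed.
Let r1_neq0 : 1 + r != 0. Proof. by rewrite lt0r_neq0 // addr_gt0. Qed.

Lemma stretch_orthogonal u : dotp u q = 0 -> dotp (stretch tau q c u) q = 0.
Proof. by move=> uq; rewrite /stretch !dotpE uq q1 (dotpC c q); ring. Qed.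

Lemma unstretch_orthogonal d : dotp d q = 0 -> dotp (unstretch tau q c d) q = 0.
Proof. by move=> dq; rewrite /unstretch !dotpE dq q1 (dotpC c q); ring. Qed.

Let tauE : tau * (1 - dotp q c ^+ 2) = (r - 1) * (r + 1).
Proof. by rewrite -subr_sqr expr1n r_sqr addrAC subrr add0r. Qed.

Lemma dotp_stretch u : dotp u q = 0 ->
  dotp (stretch tau q c u) c = r * dotp u c.
Proof.
move=> uq; rewrite /stretch -/r !dotpE c1.
rewrite (_ : _ * (1 - _) = dotp u c * (tau * (1 - dotp q c ^+ 2)) / (1 + r));
  last by field.
by rewrite tauE; field.
Qed.

Lemma stretchK u : dotp u q = 0 -> unstretch tau q c (stretch tau q c u) = u.
Proof.
move=> uq; rewrite /unstretch dotp_stretch // {1}/stretch -/r -addrA -scalerBl.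
by rewrite (_ : _ - _ = 0 :> R) ?scale0r ?addr0 //; field; apply/andP.
Qed.

Lemma unstretchK d : dotp d q = 0 -> stretch tau q c (unstretch tau q c d) = d.
Proof.
move=> dq; have ucE : dotp (unstretch tau q c d) c = dotp d c / r.
  rewrite /unstretch -/r !dotpE c1.
  rewrite (_ : _ * (1 - _) =
               dotp d c * (tau * (1 - dotp q c ^+ 2)) / ((1 + r) * r)).
    by rewrite tauE; field; apply/andP.
  by field; apply/andP.
rewrite /stretch ucE {1}/unstretch -/r -addrA -scaleNr -scalerDl.
by rewrite (_ : _ + _ = 0 :> R) ?scale0r ?addr0 //; field; apply/andP.
Qed.

Lemma sqr_stretch u : dotp u q = 0 ->
  dotp (stretch tau q c u) (stretch tau q c u) = dotp u u + tau * dotp u c ^+ 2.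
Proof.
move=> uq; rewrite {2}/stretch -/r dotpDr dotpZr dotpDr dotpNr dotpZr.
rewrite stretch_orthogonal // dotp_stretch // {1}/stretch -/r.
rewrite !dotpE (dotpC q u) uq (dotpC c u).
by field.
Qed.

End Stretch.

Lemma continuous_at_stretch_factor (T : topologicalType) (x : T) tau
    (q c : T -> V) :
  continuous_at x q -> continuous_at x c ->
  continuous_at x (fun t => stretch_factor tau (q t) (c t)).
Proof.
by move=> cq cc; rewrite /stretch_factor; continuity.
Qed.

Lemma continuous_at_stretch (T : topologicalType) (x : T) tau (q c u : T -> V) :
  continuous_at x q -> continuous_at x c -> continuous_at x u ->
  continuous_at x (fun t => stretch tau (q t) (c t) (u t)).
Proof.
move=> cq cc cu; have cr := continuous_at_stretch_factor (tau := tau) cq cc.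
rewrite /stretch; continuity => //.
by rewrite lt0r_neq0 // ltr_wpDr // sqrtr_ge0.
Qed.

Lemma continuous_at_unstretch (T : topologicalType) (x : T) tau
    (q c u : T -> V) :
  stretch_factor tau (q x) (c x) != 0 ->
  continuous_at x q -> continuous_at x c -> continuous_at x u ->
  continuous_at x (fun t => unstretch tau (q t) (c t) (u t)).
Proof.
move=> r0 cq cc cu; have cr := continuous_at_stretch_factor (tau := tau) cq cc.
rewrite /unstretch; continuity => //.
by rewrite lt0r_neq0 // ltr_wpDr // sqrtr_ge0.
Qed.

End Geometry.

(** * From the decoupled energy equation to a product of spheres *)

Section SphereBundle.
Context {R : realType}.
Local Notation V := 'rV[R]_3.
Local Notation N := (north_pole R).
Variables (kappa c0 e : R).

Definition available_energy (q2 : V) : R := c0 * (1 - height q2) + e.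

(** The energy surface once the square in the second velocity has been
    completed; [tau] measures the coupling left between [u] and [q2], and the
    surface is decoupled when it is [0]. *)
Definition sheared_surface (tau : R) : set (V * V * V * V) :=
  [set x | let: (u, y, q1, q2) := x in
    [/\ dotp q1 q1 = 1, dotp q2 q2 = 1, dotp u q1 = 0, dotp y q2 = 0 &
     dotp u u + tau * dotp u q2 ^+ 2 + dotp y y + kappa * (1 + height q1)
       = available_energy q2]].

(** A bundle over the sphere of the [q2]'s: the fibre is a 5-sphere of varying
    radius in the six-dimensional space of the triples [(b, y, a)]. *)
Definition sphere_bundle : set (V * V * (R * R) * V) :=
  [set x | let: (b, y, a, q2) := x in
    [/\ dotp b N = 0, dotp y q2 = 0, dotp q2 q2 = 1 &
     dotp b b + dotp y y + (a.1 ^+ 2 + a.2 ^+ 2) = available_energy q2]].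

Lemma sheared_surface_stretch tau : 0 <= tau ->
  homeomorphic (sheared_surface tau) (sheared_surface 0).
Proof.
move=> tau_ge0.
apply: (@homeomorphic_of_continuous_at _ _ _ _
  (fun x => (stretch tau x.1.2 x.2 x.1.1.1, x.1.1.2, x.1.2, x.2))
  (fun x => (unstretch tau x.1.2 x.2 x.1.1.1, x.1.1.2, x.1.2, x.2))).
- move=> [[[u y] q1] q2] /= [q11 q21 uq yq E]; split.
  + split=> //; first exact: stretch_orthogonal.
    by rewrite sqr_stretch // mul0r addr0.
  + by rewrite stretchK.
  + continuity; apply: continuous_at_stretch; continuity.
- move=> [[[d y] q1] q2] /= [q11 q21 dq yq]; rewrite mul0r addr0 => E; split.
  + have uq := unstretch_orthogonal tau q2 q11 dq.
    by split=> //; rewrite -(sqr_stretch tau_ge0 q11 q21 uq) unstretchK.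
  + by rewrite unstretchK.
  + continuity; apply: continuous_at_unstretch; continuity.
    exact/lt0r_neq0/stretch_factor_gt0.
Qed.

Hypotheses (c0_ge0 : 0 <= c0) (e_gt0 : 0 < e).
Hypothesis kappa_gt : 2 * c0 + e < 2 * kappa.

Lemma available_energy_gt0 q : dotp q q = 1 -> 0 < available_energy q.
Proof.
move=> /height_le h.
by rewrite /available_energy ltr_wpDl // mulr_ge0 // subr_ge0.
Qed.

Lemma available_energy_lt q : dotp q q = 1 -> available_energy q < 2 * kappa.
Proof.
move=> /height_ge h; apply: le_lt_trans kappa_gt.
rewrite lerD2r (mulrC 2) ler_wpM2l //.
by lra.
Qed.

Lemma kappa_gt0 : 0 < kappa.
Proof. by move: c0_ge0 e_gt0 kappa_gt; lra. Qed.

(** This is where the bound on the energy enters: the first pendulum cannot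
    reach the top, even if all the available energy becomes potential. *)
Lemma sheared_surface_height u y q1 q2 :
  sheared_surface 0 (u, y, q1, q2) -> height q1 < 1.
Proof.
move=> [q11 q21 uq yq E]; have := available_energy_lt q21.
have := dotp_ge0 u; have := dotp_ge0 y; have := kappa_gt0.
rewrite -E; nra.
Qed.

(** The Lambert azimuthal projection centred at the south pole, scaled so that
    the squared norm of the image is [kappa * (1 + height q)], the potential
    energy counted from the bottom.  The boundary circle of the disc, of squared
    radius [2 * kappa], corresponds to the north pole. *)
Definition lambert (q : V) : R * R :=
  (Num.sqrt kappa * q 0 0 / Num.sqrt (1 - height q),
   Num.sqrt kappa * q 0 1 / Num.sqrt (1 - height q)).

Definition lambert_height (a : R * R) : R := (a.1 ^+ 2 + a.2 ^+ 2) / kappa - 1.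

Definition unlambert (a : R * R) : V :=
  vec3 (a.1 / Num.sqrt kappa * Num.sqrt (1 - lambert_height a))
       (a.2 / Num.sqrt kappa * Num.sqrt (1 - lambert_height a))
       (lambert_height a).

Lemma lambert_heightE q : dotp q q = 1 -> height q < 1 ->
  lambert_height (lambert q) = height q.
Proof.
move=> q1 h; have k0 := kappa_gt0.
rewrite /lambert_height /= !exprMn !exprVn !sqr_sqrtr ?subr_ge0 ?ltW //.
have := oneB_height_neq0 h; move: q1; rewrite dotp3E => q1 h'.
rewrite -mulrDl -mulrDr 
  (_ : q 0 0 ^+ 2 + q 0 1 ^+ 2 = (1 - height q) * (1 + height q)).
  by field; rewrite h' lt0r_neq0.
by move: q1; lra.
Qed.

Lemma lambertK q : dotp q q = 1 -> height q < 1 -> unlambert (lambert q) = q.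
Proof.
move=> q1 h; rewrite /unlambert lambert_heightE //=.
have k0 : Num.sqrt kappa != 0 by rewrite lt0r_neq0 // sqrtr_gt0 kappa_gt0.
have h0 : Num.sqrt (1 - height q) != 0.
  by rewrite lt0r_neq0 // sqrtr_gt0 subr_gt0.
rewrite -[RHS]vec3K; congr vec3; by field; apply/andP.
Qed.

Lemma unlambertK a : lambert_height a < 1 -> lambert (unlambert a) = a.
Proof.
move=> h; rewrite /lambert /unlambert vec3_0 vec3_1 height_vec3.
have k0 : Num.sqrt kappa != 0 by rewrite lt0r_neq0 // sqrtr_gt0 kappa_gt0.
have h0 : Num.sqrt (1 - lambert_height a) != 0.
  by rewrite lt0r_neq0 // sqrtr_gt0 subr_gt0.
by case: a h h0 => a1 a2 h h0 /=; congr (_, _); field; apply/andP.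
Qed.

Lemma unlambert_sphere a : lambert_height a < 1 ->
  dotp (unlambert a) (unlambert a) = 1.
Proof.
move=> h; rewrite dotp3E /unlambert vec3_0 vec3_1 height_vec3.
rewrite -!expr2 !exprMn !exprVn !sqr_sqrtr ?subr_ge0 ?ltW ?kappa_gt0 //.
have k0 := lt0r_neq0 kappa_gt0.
by rewrite /lambert_height; field.
Qed.

Lemma sheared_surface_sphere_bundle :
  homeomorphic (sheared_surface 0) sphere_bundle.
Proof.
have k0 := kappa_gt0.
apply: (@homeomorphic_of_continuous_at _ _ _ _
  (fun x => (swap_north x.1.2 x.1.1.1, x.1.1.2, lambert x.1.2, x.2))
  (fun x => (swap_north (unlambert x.1.2) x.1.1.1, x.1.1.2, unlambert x.1.2,
             x.2))).
- move=> [[[d y] q1] q2] D; have h := sheared_surface_height D.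
  have [q11 q21 dq yq E] /= := D; have hl := lambert_heightE q11 h; split.
  + split=> //; first by rewrite dotp_swap_north // swap_north_north.
    rewrite dotp_swap_north // swap_northK // -E mul0r addr0 -[in RHS]hl.
    rewrite /lambert_height /=; field.
    by rewrite !lt0r_neq0 // sqrtr_gt0 subr_gt0.
  + by rewrite lambertK // swap_northK.
  + have h0 : Num.sqrt (1 - height q1) != 0.
      by rewrite lt0r_neq0 // sqrtr_gt0 subr_gt0.
    rewrite /lambert; continuity => //.
    apply: continuous_at_swap_north => //; continuity.
- move=> [[[b y] a] q2] /= [bN yq q21 E].
  have h : lambert_height a < 1.
    rewrite /lambert_height ltrBlDr ltr_pdivrMr // -[1 + 1]/2.
    have := available_energy_lt q21; rewrite -E.
    have := dotp_ge0 b; have := dotp_ge0 y; lra.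
  have q11 := unlambert_sphere h.
  have h' : height (unlambert a) < 1 by rewrite height_vec3.
  split.
  + split=> //; first by rewrite dotp_swap_north // swap_north_self.
    rewrite dotp_swap_north // swap_northK // -E mul0r addr0 height_vec3
      /lambert_height.
    by field; apply: lt0r_neq0.
  + by rewrite swap_northK // unlambertK.
  + have kk : Num.sqrt kappa != 0 by rewrite lt0r_neq0 // sqrtr_gt0.
    have cu : continuous_at (b, y, a, q2)
        (fun x : V * V * (R * R) * V => unlambert x.1.2).
      by rewrite /unlambert /lambert_height; continuity; rewrite ?lt0r_neq0.
    continuity => //.
    apply: continuous_at_swap_north => //; continuity.
Qed.

(** A tangent vector [y] at [q] and a scalar [t] amount to [y + t *: q], which
    identifies the sum of the tangent bundle and a trivial line with a trivial
    bundle of rank three.  Each coordinate of [a] serves as such a scalar, once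
    at [N] for [b] and once at [q2] for [y]. *)
Lemma sphere_bundle_spheres :
  homeomorphic sphere_bundle (sphere R 2 `*` sphere R 5).
Proof.
pose f (x : V * V * (R * R) * V) : V * 'rV[R]_(3 + 3) :=
  (x.2, (Num.sqrt (available_energy x.2))^-1 *:
        row_mx (x.1.1.1 + x.1.2.1 *: N) (x.1.1.2 + x.1.2.2 *: x.2)).
pose g (x : V * 'rV[R]_(3 + 3)) : V * V * (R * R) * V :=
  let w1 := Num.sqrt (available_energy x.1) *: lsubmx x.2 in
  let w2 := Num.sqrt (available_energy x.1) *: rsubmx x.2 in
  (w1 - dotp w1 N *: N, w2 - dotp w2 x.1 *: x.1, (dotp w1 N, dotp w2 x.1), x.1).
have NN : dotp N N = 1 by rewrite dotp_north height_north.
apply: (@homeomorphic_of_continuous_at _ _ _ _ f g).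
- move=> [[[b y] [a1 a2]] q] /= [bN yq q1 E].
  have A0 := available_energy_gt0 q1.
  have s0 : Num.sqrt (available_energy q) != 0.
    by rewrite lt0r_neq0 // sqrtr_gt0.
  split.
  + split => //.
    (* The width of the ambient row vectors is displayed as [6]; the block
       decomposition needs it in the form [3 + 3]. *)
    rewrite /sphere /= -[LHS]/(@dotp R (3 + 3) _ _).
    rewrite dotpZl dotpZr dotp_row_mx.
    rewrite !dotpE (dotpC N b) (dotpC q y) bN yq NN q1 mulrA -expr2 exprVn.
    rewrite sqr_sqrtr ?ltW // -E.
    rewrite -E in A0; have := lt0r_neq0 A0 => /= A0'.
    by field.
  + rewrite /g /f /= scale_row_mx row_mxKl row_mxKr !scalerA divff // !scale1r.
    rewrite !dotpDl !dotpZl bN yq NN q1 !mulr1 !add0r.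
    by rewrite !addrK.
  + by rewrite /f /available_energy; continuity.
- move=> [q W] /= [/= q1 W1].
  have A0 := available_energy_gt0 q1.
  have s0 : Num.sqrt (available_energy q) != 0.
    by rewrite lt0r_neq0 // sqrtr_gt0.
  split.
  + rewrite /g /=; split => //; try by rewrite !dotpE ?NN ?q1; ring.
    have WE : @dotp R (3 + 3) W W = 1 by exact: W1.
    rewrite -[RHS]mulr1 -WE.
    rewrite -[X in _ = _ * dotp X X]hsubmxK dotp_row_mx.
    rewrite !dotpE (dotpC N) (dotpC q) NN q1.
    rewrite -[in RHS](sqr_sqrtr (ltW A0)).
    ring.
  + rewrite /f /g /= !subrK; congr (_, _).
    rewrite -[RHS](hsubmxK (W : 'rV[R]_(3 + 3))) -scale_row_mx.
    by rewrite scalerA mulVf // scale1r.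
  + by rewrite /g /available_energy; continuity.
Qed.

End SphereBundle.

(** * The energy surface of the pendulum *)

Section Pendulum.
Context {R : realType}.
Local Notation V := 'rV[R]_3.
Variables m1 m2 l1 l2 g : R.
Hypotheses (m1_gt0 : 0 < m1) (m2_gt0 : 0 < m2).
Hypotheses (l1_gt0 : 0 < l1) (l2_gt0 : 0 < l2).

Let m1n : m1 != 0 := lt0r_neq0 m1_gt0.
Let m2n : m2 != 0 := lt0r_neq0 m2_gt0.
Let l1n : l1 != 0 := lt0r_neq0 l1_gt0.
Let l2n : l2 != 0 := lt0r_neq0 l2_gt0.

Local Notation k := (slope m1 m2 l1 l2).
Local Notation c0 := (g * m2 * l2).

(** The energy surface in the variables [u = l1 *: q1'] and [w = l2^-1 *: p2],
    in which the kinetic energy is diagonal; the price is that the tangency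
    condition of the second pendulum now couples [w] to [u]. *)
Definition velocity_surface (e : R) : set (V * V * V * V) :=
  [set x | let: (u, w, q1, q2) := x in
    [/\ dotp q1 q1 = 1, dotp q2 q2 = 1, dotp u q1 = 0,
        dotp w q2 = m2 * dotp u q2 &
     (m1 * dotp u u + m2^-1 * dotp w w) / 2 + c0 * k * (1 + height q1)
       = available_energy c0 e q2]].

Lemma hamiltonian_P2 : hamiltonian m1 m2 l1 l2 g (P2 R) = c0 * (1 - k).
Proof.
rewrite /hamiltonian /P2 /potential !scaler0 subr0 !sqr_enorm !dotp3E /height
  !mxE /=.
ring.
Qed.

(** The product of [l1] and the velocity of the first pendulum. *)
Definition scaled_velocity (p1 p2 : V) : V :=
  m1^-1 *: (l1^-1 *: p1 - l2^-1 *: p2).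

Lemma velocity_surfaceE e p1 p2 q1 q2 :
  energy_surface m1 m2 l1 l2 g (hamiltonian m1 m2 l1 l2 g (P2 R) + e)
    (p1, p2, q1, q2)
  <-> velocity_surface e (scaled_velocity p1 p2, l2^-1 *: p2, q1, q2).
Proof.
rewrite hamiltonian_P2.
set u := scaled_velocity p1 p2; set w := l2^-1 *: p2.
have v1E : velocity1 m1 l1 l2 p1 p2 = l1^-1 *: u.
  by rewrite /velocity1 /u /scaled_velocity [m1^-1 *: _]scalerBr !scalerA
    !invfM.
have v2E : velocity2 m1 m2 l1 l2 p1 p2 = l2^-1 *: (m2^-1 *: w - u).
  rewrite /velocity2 /u /w /scaled_velocity [m1^-1 *: _]scalerBr !scalerA
    !invfM.
  by rewrite opprB addrA addrAC.
have p1E : l1^-1 *: p1 - l2^-1 *: p2 = m1 *: u.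
  by rewrite scalerA divff // scale1r.
have c1 : (dotp q1 (velocity1 m1 l1 l2 p1 p2) = 0) <-> (dotp u q1 = 0).
  rewrite v1E dotpZr dotpC; split=> [/eqP|->]; last by rewrite mulr0.
  by rewrite mulf_eq0 invr_eq0 (negbTE l1n) => /eqP.
have c2 : (dotp q2 (velocity2 m1 m2 l1 l2 p1 p2) = 0) <->
    (dotp w q2 = m2 * dotp u q2).
  rewrite v2E dotpC dotpZl dotpDl dotpNl dotpZl; split=> [/eqP|->].
    rewrite mulf_eq0 invr_eq0 (negbTE l2n) /= subr_eq0 => /eqP <-.
    by rewrite mulVKf.
  by rewrite mulKf // subrr mulr0.
have c3 : (hamiltonian m1 m2 l1 l2 g (p1, p2, q1, q2) = c0 * (1 - k) + e) <->
    ((m1 * dotp u u + m2^-1 * dotp w w) / 2 + c0 * k * (1 + height q1)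
       = available_energy c0 e q2).
  rewrite /hamiltonian p1E -/w !sqr_enorm dotpZl dotpZr mulKf //
    /available_energy /potential.
  by split; lra.
by split=> [[[q11 q21 /c1 uq /c2 wq] /c3 E]|[q11 q21 /c1 uq /c2 wq /c3 E]].
Qed.

Lemma energy_surface_velocity e :
  homeomorphic
    (energy_surface m1 m2 l1 l2 g (hamiltonian m1 m2 l1 l2 g (P2 R) + e))
    (velocity_surface e).
Proof.
apply: (@homeomorphic_of_continuous_at _ _ _ _
  (fun x : V * V * V * V =>
     (scaled_velocity x.1.1.1 x.1.1.2, l2^-1 *: x.1.1.2, x.1.2, x.2))
  (fun x : V * V * V * V =>
     (l1 *: (m1 *: x.1.1.1 + x.1.1.2), l2 *: x.1.1.2, x.1.2, x.2))).
- move=> [[[p1 p2] q1] q2] D; split.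
  + exact/velocity_surfaceE.
  + rewrite /scaled_velocity /= !scalerA divff // scale1r subrK scalerA divff
    // scale1r.
    by rewrite divff // scale1r.
  + by rewrite /scaled_velocity; continuity.
- move=> [[[u w] q1] q2] D.
  have E : (scaled_velocity (l1 *: (m1 *: u + w)) (l2 *: w),
            l2^-1 *: (l2 *: w), q1, q2) = (u, w, q1, q2).
    by rewrite /scaled_velocity !scalerA !mulVf // !scale1r addrK scalerA
      mulVf // scale1r.
  split => //; last by continuity.
  by apply/velocity_surfaceE; rewrite E.
Qed.

(** The tangency condition fixes the component of [w] along [q2] as
    [m2 * (u . q2)], so that [w] is determined by [u] and its component [y]
    orthogonal to [q2], and the square of the fixed component becomes part of
    the form in [u], with relative weight [m2 / m1].  The factors [s1], [s2]
    absorb the masses. *)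
Lemma velocity_surface_sheared e :
  homeomorphic (velocity_surface e) (sheared_surface (c0 * k) c0 e (m2 / m1)).
Proof.
pose s1 := Num.sqrt (m1 / 2); pose s2 := Num.sqrt (2 * m2).
have s1n : s1 != 0 by rewrite lt0r_neq0 // sqrtr_gt0 divr_gt0.
have s2n : s2 != 0 by rewrite lt0r_neq0 // sqrtr_gt0 mulr_gt0.
have s1E : s1 ^+ 2 = m1 / 2 by rewrite sqr_sqrtr // ltW // divr_gt0.
have s2E : s2 ^+ 2 = 2 * m2 by rewrite sqr_sqrtr // ltW // mulr_gt0.
apply: (@homeomorphic_of_continuous_at _ _ _ _
  (fun x : V * V * V * V =>
     (s1 *: x.1.1.1, s2^-1 *: (x.1.1.2 - dotp x.1.1.2 x.2 *: x.2), x.1.2, x.2))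
  (fun x : V * V * V * V =>
     (s1^-1 *: x.1.1.1, s2 *: x.1.1.2 + (m2 / s1 * dotp x.1.1.1 x.2) *: x.2,
      x.1.2, x.2))).
- move=> [[[u w] q1] q2] [q11 q21 uq wq E] /=; split.
  + split => //.
    * by rewrite dotpZl uq mulr0.
    * by rewrite !dotpE q21; ring.
    * have -> : dotp (s1 *: u) (s1 *: u) = m1 / 2 * dotp u u.
        by rewrite dotpZl dotpZr mulrA -expr2 s1E.
      have -> : forall z : V,
          dotp (s2^-1 *: z) (s2^-1 *: z) = dotp z z / (2 * m2).
        by move=> z; rewrite dotpZl dotpZr mulrA -expr2 exprVn s2E mulrC.
      rewrite -E !dotpE q21 (dotpC q2 w) wq exprMn s1E.
      by field; apply/andP.
  + rewrite !scalerA mulVf // divff // !scale1r.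
    by rewrite dotpZl mulrA divfK // -wq subrK.
  + by continuity.
- move=> [[[u y] q1] q2] [q11 q21 uq yq E] /=; split.
  + split => //.
    * by rewrite dotpZl uq mulr0.
    * by rewrite !dotpE yq q21; ring.
    * have m1E : m1 = 2 * s1 ^+ 2 by rewrite s1E; field.
      rewrite -E !dotpE q21 (dotpC q2 y) yq.
      rewrite [s2 * (s2 * _)]mulrA -expr2 s2E m1E.
      by field; apply/andP.
  + rewrite !scalerA divff // scale1r.
    by rewrite !dotpE yq q21 mulr0 add0r mulr1 addrK scalerA mulVf // scale1r.
  + by continuity.
Qed.

End Pendulum.

Theorem proposition3p4 (R : realType) (m1 m2 l1 l2 g : R)
    (m1_gt0 : 0 < m1) (m2_gt0 : 0 < m2)
    (l1_gt0 : 0 < l1) (l2_gt0 : 0 < l2) (g_gt0 : 0 < g)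
    (slope_gt1 : 1 < slope m1 m2 l1 l2) :
  \forall e \near (0 : R)^'+,
    homeomorphic
      (energy_surface m1 m2 l1 l2 g (hamiltonian m1 m2 l1 l2 g (P2 R) + e))
      (sphere R 2 `*` sphere R 5).
Proof.
set k := slope m1 m2 l1 l2 in slope_gt1 *; set c0 := g * m2 * l2.
have c0_gt0 : 0 < c0 by rewrite !mulr_gt0.
near=> e.
have e_gt0 : 0 < e by [].
(* The smallness of [e]: [kappa > c0] leaves room below [2 * kappa]. *)
have e_lt : 2 * c0 + e < 2 * (c0 * k).
  rewrite -ltrBrDl (_ : _ - _ = 2 * c0 * (k - 1)); last by ring.
  near: e; apply: nbhs_right_lt.
  by rewrite !mulr_gt0 // subr_gt0.
apply: homeomorphic_trans (energy_surface_velocity g m1_gt0 m2_gt0 l1_gt0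
  l2_gt0 e) _.
apply: homeomorphic_trans (velocity_surface_sheared l1 l2 g m1_gt0 m2_gt0 e) _.
have tau_ge0 : 0 <= m2 / m1 by rewrite divr_ge0 // ltW.
apply: homeomorphic_trans (sheared_surface_stretch _ _ _ tau_ge0) _.
apply: homeomorphic_trans (sphere_bundle_spheres (ltW c0_gt0) e_gt0).
exact: sheared_surface_sphere_bundle (ltW c0_gt0) e_gt0 e_lt.
Unshelve. all: by end_near. Qed.
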